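(* Suppose that $f$ satisfies the approximate sharpness condition $$d(x,\widehat X)\le\Big(\frac{f(x)-\hat f+g_Q(x)+\eta}{\alpha}\Big)^{1/\beta}\qquad\forall x\in D$$ for some (unknown) constants $\alpha>0$, $\beta\ge1$, $\eta\ge0$. Consider the grid-search restart scheme (defined in the context) for fixed $a,b>1$, $0<r<1$, $\alpha_0>0$, $\beta_0\ge1$ with $\beta\ge\beta_0$, any $h$-assignment $\phi$ over $S$, and one of the following choices of $S$ and schedule criterion $h$: (i) (unknown $\alpha$ and $\beta$) $S=\mathbb Z\times\mathbb N_0\times\mathbb N$ and $h(x_1,x_2,x_3)=(x_1+1)^{c_1}(x_2+1)^{c_2}x_3$ with $c_1,c_2>1$; (ii) (known $\alpha$, unknown $\beta$) $\alpha=a^{i}\alpha_0$ for some $i\in\mathbb Z$, $S=\{i\}\times\mathbb N_0\times\mathbb N$ and $h(x_1,x_2,x_3)=(x_2+1)^{c_2}x_3$ with $c_2>1$; (iii) (unknown $\alpha$, known $\beta$) $\beta=\beta_0$, $S=\mathbb Z\times\{0\}\times\mathbb N$ and $h(x_1,x_2,x_3)=(x_1+1)^{c_1}x_3$ with $c_1>1$. Let $\alpha_*=a^{\lfloor\log_a(\alpha/\alpha_0)\rfloor}\alpha_0$, $\beta_*=b^{\lceil\log_b(\beta/\beta_0)\rceil}\beta_0$, and for $\varepsilon\in(0,\epsilon_0)$ let $$K(\varepsilon)=\sum_{q=1}^{\lceil\log(\epsilon_0/\varepsilon)/\log(1/r)\rceil}\mathcal C_\Gamma(\delta_q,r^q\epsilon_0),\qquad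 \delta_q=\Big[\max\Big\{1,\tfrac{2r^{q-1}\epsilon_0}{\alpha_*}\Big\}\Big]^{\min\{b/\beta_*,1/\beta_0\}}\Big[\min\Big\{1,\tfrac{2r^{q-1}\epsilon_0}{\alpha_*}\Big\}\Big]^{1/\beta_*}.$$ Then running the scheme with $$t\gtrsim K(\varepsilon),\qquad\varepsilon\to0^+,$$ (total inner) iterations (that is, $t\ge c\,K(\varepsilon)$ for a suitable constant $c>0$ independent of $\varepsilon$, for all sufficiently small $\varepsilon>0$) implies that $$f(x^{(t)})-\hat f+g_Q(x^{(t)})\le\max\{\eta,\varepsilon\}.$$ If, in addition, there are constants $C,d_1,d_2>0$ with $\mathcal C_\Gamma(\delta,\epsilon)\le C\delta^{d_1}/\epsilon^{d_2}+1$ for all $\delta,\epsilon>0$, then $$K(\varepsilon)\le\hat C\begin{cases}\epsilon_0^{d_1/\beta_*-d_2}\lceil\log(\epsilon_0/\varepsilon)\rceil,&\text{if }d_2\le d_1/\beta_*,\\ \varepsilon^{d_1/\beta_*-d_2}\lceil\log(\epsilon_0/\varepsilon)\rceil,&\text{if }d_2>d_1/\beta_*,\end{cases}$$ where $\hat C$ is independent of $\varepsilon$ (but depends on $r,a,b,\alpha,\beta_*,\alpha_0,\beta_0,d_1$ and $d_2$).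
   Context: Notation: $\mathbb N=\{1,2,\dots\}$, $\mathbb N_0=\{0\}\cup\mathbb N$, $\mathbb R_+=[0,\infty)$, $\mathbb R_{++}=(0,\infty)$. Problem. $f:D\to\mathbb R$ is a proper, closed convex function with non-empty effective domain $D\subseteq\mathbb C^n$, and $Q\subseteq\mathbb C^n$ is closed and convex with $Q\subset D$. The problem is $\min_{x\in Q}f(x)$; $\hat f$ is its optimal value and $\widehat X$ the set of minimizers of $f$ over $Q$, assumed non-empty. $d$ is a metric on $\mathbb C^n$ and $d(x,S)=\inf_{z\in S}d(x,z)$. $g_Q:D\to\mathbb R_+$ is a function with $g_Q(x)=0\iff x\in Q$, and such that $g_Q(x_m)\to0$ whenever $\{x_m\}\subset D$ satisfies $d(x_m,Q)\to0$. First-order method. $\Gamma:\mathbb R_{++}\times\mathbb R_{++}\times D\to D$ is an (iterative) algorithm such that, whenever $d(x_0,\widehat X)\le\delta$, the output $x=\Gamma(\delta,\epsilon,x_0)$ satisfies $f(x)-\hat f+g_Q(x)\le\epsilon$. The cost function $\mathcal C_\Gamma:\mathbb R_{++}\times\mathbb R_{++}\to\mathbb N$ is such that $\mathcal C_\Gamma(\delta,\epsilon)$ is an upper bound on the number of iterations $\Gamma$ needs to compute $\Gamma(\delta,\epsilon,x_0)$ for any $x_0$ with $d(x_0,\widehat X)\le\delta$; it is non-decreasing in its first argument and non-increasing in its second. Schedules. A schedule criterion is a function $h:\mathbb R_+\times\mathbb R_+\times\mathbb R_{++}\to\mathbb R_{++}$ that is non-decreasing in its first and second arguments and strictly increasing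 in its third. Given an infinite set $S\subseteq\mathbb Z\times\mathbb N_0\times\mathbb N$, an $h$-assignment over $S$ is a bijection $\phi:\mathbb N\to S$ that lists $S$ in order of non-decreasing $h$: for all $(i,j,k),(i',j',k')\in S$, $\phi^{-1}(i',j',k')\le\phi^{-1}(i,j,k)$ implies $h(|i'|,j',k')\le h(|i|,j,k)$. Grid-search restart scheme. Inputs: $\Gamma$, $\phi$, $x^{(0)}\in D$, $\epsilon_0>0$ with $f(x^{(0)})-\hat f+g_Q(x^{(0)})\le\epsilon_0$, constants $a,b>1$, $r\in(0,1)$, $\alpha_0>0$, $\beta_0\ge1$, and $t\in\mathbb N$ (the total number of inner iterations). Initialize $U_{i,j}=0$, $V_{i,j}=0$, $\epsilon_{i,j,0}=\epsilon_0$ for all $i\in\mathbb Z,j\in\mathbb N_0$. For $m=0,1,\dots,t-1$: set $(i,j,k)=\phi(m+1)$, $\alpha_i=a^i\alpha_0$, $\beta_j=b^j\beta_0$, $U=U_{i,j}$, $V=V_{i,j}$, $\epsilon_{i,j,U+1}=r\epsilon_{i,j,U}$; set $\delta_{i,j,U+1}=(2\epsilon_{i,j,U}/\alpha_i)^{\min\{b/\beta_j,1/\beta_0\}}$ if $2\epsilon_{i,j,U}>\alpha_i$ and $\delta_{i,j,U+1}=(2\epsilon_{i,j,U}/\alpha_i)^{1/\beta_j}$ otherwise. If $V+\mathcal C_\Gamma(\delta_{i,j,U+1},\epsilon_{i,j,U+1})\le k$, then set $z^{(m)}=\Gamma(\delta_{i,j,U+1},\epsilon_{i,j,U+1},x^{(m)})$,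 let $x^{(m+1)}$ be a minimizer of $f+g_Q$ over $\{z^{(m)},x^{(m)}\}$, and update $V_{i,j}=V+\mathcal C_\Gamma(\delta_{i,j,U+1},\epsilon_{i,j,U+1})$, $U_{i,j}=U+1$; otherwise set $x^{(m+1)}=x^{(m)}$. Output: $x^{(t)}$.
   Formalization: The constant Ĉ, still independent of ε, is allowed to depend also on C and ε_0, which the list of dependencies omits; a bound uniform in C (or, in general, in ε_0) is false. *)

(* Defs.v *)
From HB Require Import structures.
From mathcomp Require Import all_boot all_order all_algebra.
From mathcomp Require Import complex.
From mathcomp Require Import all_classical all_reals all_analysis.

Set Implicit Arguments.
Unset Strict Implicit.
Unset Printing Implicit Defensive.

Import Order.TTheory GRing.Theory Num.Theory.
Import numFieldNormedType.Exports.
Local Open Scope classical_set_scope.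
Local Open Scope ring_scope.

(* The cast to numFieldType is what gives C^n its usual topology. *)
Notation Cn R n := ('cV[(R[i])%C : numFieldType]_n).

Section Problem.
Context {R : realType} {n : nat}.
Implicit Types (D Q S : set (Cn R n)) (f g : Cn R n -> R).
Implicit Types (d : Cn R n -> Cn R n -> R).

Definition segment_point (t : R) (x y : Cn R n) : Cn R n :=
  t%:C%C *: x + (1 - t)%:C%C *: y.

Definition convex_subset S : Prop :=
  forall x y t, S x -> S y -> 0 <= t <= 1 -> S (segment_point t x y).

Definition convex_on D f : Prop :=
  convex_subset D /\
  forall x y t, D x -> D y -> 0 <= t <= 1 ->
    f (segment_point t x y) <= t * f x + (1 - t) * f y.

(* A function with effective domain D is a total function f of which only the
   values on D matter: it stands for the function equal to f on D and to +oo
   elsewhere. *)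
Definition epigraph D f : set (Cn R n * R)%type :=
  [set p | D p.1 /\ f p.1 <= p.2].

Definition optimal_value f Q : R := inf (f @` Q).

Definition minimizers f Q : set (Cn R n) :=
  [set x | Q x /\ forall y, Q y -> f x <= f y].

Record convex_problem D f Q : Prop := {
  dom_nonempty : D !=set0 ;
  objective_closed : closed (epigraph D f) ;
  objective_convex : convex_on D f ;
  feasible_closed : closed Q ;
  feasible_convex : convex_subset Q ;
  feasible_dom : Q `<=` D ;
  minimizers_nonempty : minimizers f Q !=set0 }.

(* The metric need not induce the usual topology of C^n, so it is not an
   instance of the library's metricType on that type. *)
Record is_metric d : Prop := {
  metric_ge0 : forall x y, 0 <= d x y ;
  metric_eq0 : forall x y, d x y = 0 <-> x = y ;
  metric_sym : forall x y, d x y = d y x ;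
  metric_triangle : forall x y z, d x z <= d x y + d y z }.

Definition dist_to d (x : Cn R n) S : R := inf (d x @` S).

Record feasibility_gap D Q d g : Prop := {
  fgap_ge0 : forall x, D x -> 0 <= g x ;
  fgap_eq0 : forall x, D x -> (g x = 0 <-> Q x) ;
  fgap_cvg : forall u : nat -> Cn R n, (forall m, D (u m)) ->
    dist_to d (u m) Q @[m --> \oo] --> (0 : R) ->
    g (u m) @[m --> \oo] --> (0 : R) }.

Definition total_gap f Q g (x : Cn R n) : R := f x - optimal_value f Q + g x.

(* The first conjunct says that the base of the (in general fractional) power
   is nonnegative, without which the power is meaningless; powR would take the
   junk value 1 on a negative base. *)
Definition approx_sharp D f Q g d (alpha beta eta : R) : Prop :=
  forall x, D x ->
    0 <= total_gap f Q g x + eta /\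
    dist_to d x (minimizers f Q)
      <= ((total_gap f Q g x + eta) / alpha) `^ (1 / beta).

(* [iters delta eps x] is the number of iterations that the algorithm performs
   to compute [Gamma delta eps x]. *)
Record first_order_method D f Q g d
    (Gamma : R -> R -> Cn R n -> Cn R n) (iters : R -> R -> Cn R n -> nat)
    (cost : R -> R -> nat) : Prop := {
  method_dom : forall delta eps x, 0 < delta -> 0 < eps -> D x ->
    D (Gamma delta eps x) ;
  method_accuracy : forall delta eps x, 0 < delta -> 0 < eps -> D x ->
    dist_to d x (minimizers f Q) <= delta ->
    total_gap f Q g (Gamma delta eps x) <= eps ;
  cost_gt0 : forall delta eps, 0 < delta -> 0 < eps ->
    (0 < cost delta eps)%N ;
  cost_bound : forall delta eps x, 0 < delta -> 0 < eps -> D x ->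
    dist_to d x (minimizers f Q) <= delta ->
    (iters delta eps x <= cost delta eps)%N ;
  cost_homol : forall delta delta' eps, 0 < delta -> delta <= delta' ->
    0 < eps -> (cost delta eps <= cost delta' eps)%N ;
  cost_antir : forall delta eps eps', 0 < delta -> 0 < eps -> eps <= eps' ->
    (cost delta eps' <= cost delta eps)%N }.

End Problem.

(* Triples (i, j, k), i.e. ((i, j), k), in Z x N_0 x N, where N starts at 1. *)
Definition grid : set (int * nat * nat)%type := [set s | (0 < s.2)%N].

Section Schedule.
Context {R : realType}.
Implicit Types (h : R -> R -> R -> R) (S : set (int * nat * nat)%type).

Record schedule_criterion h : Prop := {
  criterion_gt0 : forall x1 x2 x3, 0 <= x1 -> 0 <= x2 -> 0 < x3 ->
    0 < h x1 x2 x3 ;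
  criterion_homo1 : forall x1 y1 x2 x3, 0 <= x1 -> x1 <= y1 -> 0 <= x2 ->
    0 < x3 -> h x1 x2 x3 <= h y1 x2 x3 ;
  criterion_homo2 : forall x1 x2 y2 x3, 0 <= x1 -> 0 <= x2 -> x2 <= y2 ->
    0 < x3 -> h x1 x2 x3 <= h x1 y2 x3 ;
  criterion_homo3 : forall x1 x2 x3 y3, 0 <= x1 -> 0 <= x2 -> 0 < x3 ->
    x3 < y3 -> h x1 x2 x3 < h x1 x2 y3 }.

Definition criterion_at h (s : int * nat * nat) : R :=
  h (absz s.1.1)%:R s.1.2%:R s.2%:R.

Record h_assignment h S (phi : nat -> int * nat * nat) : Prop := {
  assignment_criterion : schedule_criterion h ;
  assignment_grid : S `<=` grid ;
  assignment_infinite : infinite_set S ;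
  assignment_bij : set_bij [set m : nat | (0 < m)%N] S phi ;
  assignment_sorted : forall m m', (0 < m')%N -> (m' <= m)%N ->
    criterion_at h (phi m') <= criterion_at h (phi m) }.

Definition unknown_alpha_beta S h : Prop :=
  S = grid /\
  exists c1 c2 : R, [/\ 1 < c1, 1 < c2 &
    forall x1 x2 x3, 0 <= x1 -> 0 <= x2 -> 0 < x3 ->
      h x1 x2 x3 = (x1 + 1) `^ c1 * (x2 + 1) `^ c2 * x3].

Definition known_alpha (a alpha0 alpha : R) S h : Prop :=
  exists2 i : int,
    alpha = a ^ i * alpha0 /\ S = [set s | s.1.1 = i /\ (0 < s.2)%N] &
  exists2 c2 : R, 1 < c2 &
    forall x1 x2 x3, 0 <= x1 -> 0 <= x2 -> 0 < x3 ->
      h x1 x2 x3 = (x2 + 1) `^ c2 * x3.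

Definition known_beta (beta0 beta : R) S h : Prop :=
  [/\ beta = beta0, S = [set s | s.1.2 = 0%N /\ (0 < s.2)%N] &
  exists2 c1 : R, 1 < c1 &
    forall x1 x2 x3, 0 <= x1 -> 0 <= x2 -> 0 < x3 ->
      h x1 x2 x3 = (x1 + 1) `^ c1 * x3].

End Schedule.

Section Scheme.
Context {R : realType} {n : nat}.

(* [used] is the table U_(i,j), [spent] the table V_(i,j), and [accuracy] the
   table eps_(i,j,u). *)
Record state := State {
  iterate : Cn R n ;
  used : int -> nat -> nat ;
  spent : int -> nat -> nat ;
  accuracy : int -> nat -> nat -> R }.

Definition update2 (T : Type) (u : int -> nat -> T) (i : int) (j : nat)
    (v : T) : int -> nat -> T :=
  fun i' j' => if (i' == i) && (j' == j) then v else u i' j'.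

Definition update3 (T : Type) (u : int -> nat -> nat -> T) (i : int)
    (j k : nat) (v : T) : int -> nat -> nat -> T :=
  fun i' j' k' =>
    if [&& i' == i, j' == j & k' == k] then v else u i' j' k'.

Definition radius (a b alpha0 beta0 : R) (i : int) (j : nat) (e : R) : R :=
  let alpha_i := a ^ i * alpha0 in
  let beta_j := b ^+ j * beta0 in
  if alpha_i < 2 * e
  then (2 * e / alpha_i) `^ Num.min (b / beta_j) (1 / beta0)
  else (2 * e / alpha_i) `^ (1 / beta_j).

Variables (f g : Cn R n -> R) (Gamma : R -> R -> Cn R n -> Cn R n).
Variables (cost : R -> R -> nat) (phi : nat -> int * nat * nat).
Variables (a b r alpha0 beta0 eps0 : R) (x0 : Cn R n).

(* A relation and not a function, because the scheme may take either point as
   the minimizer of f + g over {z, x} in case of a tie. *)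
Definition restart_step (m : nat) (s s' : state) : Prop :=
  let: (i, j, k) := phi m.+1 in
  let U := used s i j in
  let V := spent s i j in
  let eps := accuracy s i j U in
  let eps' := r * eps in
  let delta := radius a b alpha0 beta0 i j eps in
  let x := iterate s in
  let z := Gamma delta eps' x in
  let F y := f y + g y in
  accuracy s' = update3 (accuracy s) i j U.+1 eps' /\
  if (V + cost delta eps' <= k)%N
  then [/\ iterate s' = z \/ iterate s' = x,
           F (iterate s') <= F z, F (iterate s') <= F x,
           spent s' = update2 (spent s) i j (V + cost delta eps')%N &
           used s' = update2 (used s) i j U.+1]
  else [/\ iterate s' = x, spent s' = spent s & used s' = used s].

Definition restart_init (s : state) : Prop :=
  [/\ iterate s = x0, forall i j, used s i j = 0%N,
      forall i j, spent s i j = 0%N &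
      forall i j, accuracy s i j 0%N = eps0].

Definition restart_run (t : nat) (s : nat -> state) : Prop :=
  restart_init (s 0%N) /\
  forall m, (m < t)%N -> restart_step m (s m) (s m.+1).

End Scheme.

Section Bound.
Context {R : realType}.
Implicit Types (a b r alpha beta eps e : R).

Definition alpha_star a alpha0 alpha : R :=
  a ^ Num.floor (ln (alpha / alpha0) / ln a) * alpha0.

Definition beta_star b beta0 beta : R :=
  b ^ Num.ceil (ln (beta / beta0) / ln b) * beta0.

Definition star_radius b r beta0 eps0 (alphas betas : R) (q : nat) : R :=
  let y := 2 * r ^+ q.-1 * eps0 / alphas in
  Num.max 1 y `^ Num.min (b / betas) (1 / beta0)
    * Num.min 1 y `^ (1 / betas).

(* For 0 < e < eps0 and 0 < r < 1 the ceiling is positive, so that taking its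
   absolute value is only a conversion to nat. *)
Definition restart_count r eps0 e : nat :=
  absz (Num.ceil (ln (eps0 / e) / ln (1 / r))).

Definition total_cost (cost : R -> R -> nat) b r beta0 eps0
    (alphas betas e : R) : nat :=
  (\sum_(1 <= q < (restart_count r eps0 e).+1)
    cost (star_radius b r beta0 eps0 alphas betas q) (r ^+ q * eps0)%R)%N.

End Bound.

(* Main.v *)
(* Only the grid point (i, j) with a^i alpha0 = alpha_* and b^j beta0 = beta_*
   matters. There the sharpness condition puts the minimizers within the chosen
   radius as long as the gap is at least eta, so after U restarts at (i, j) the gap
   is at most max(eta, r^U eps0); the other grid points never increase it. Since
   the budget k at (i, j) grows by one at a time and every restart costs at least
   one, p restarts are completed as soon as k reaches the sum K of their costs.
   The triple (i, j, K) is reached early: the triples listed before it have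
   w(i', j') k' <= w(i, j) K, where h = w k, so at most K w(i, j) sum 1/w of them
   exist, and sum 1/w converges because the exponents exceed 1. *)

Require Import Defs.
From HB Require Import structures.
From mathcomp Require Import all_boot all_order all_algebra.
From mathcomp Require Import complex.
From mathcomp Require Import all_classical all_reals all_analysis.
From mathcomp Require Import ring lra zify.

Set Implicit Arguments.
Unset Strict Implicit.
Unset Printing Implicit Defensive.

Import Order.TTheory GRing.Theory Num.Theory.
Import numFieldNormedType.Exports.
Local Open Scope classical_set_scope.
Local Open Scope ring_scope.

(** * Convergent weight series and the rank of a triple in an [h]-assignment *)

Section Counting.
Context {R : realType}.

Lemma ler_sum_subseq (T : eqType) (F : T -> R) (s s' : seq T) :
  uniq s -> uniq s' -> {subset s <= s'} -> (forall x, 0 <= F x) ->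
  \sum_(x <- s) F x <= \sum_(x <- s') F x.
Proof.
move=> us us' ss' F0.
have p : perm_eq s [seq x <- s' | x \in s].
  apply: uniq_perm => // [|x]; first exact: filter_uniq.
  by rewrite mem_filter; case: (boolP (x \in s)) => // /ss' ->.
rewrite (perm_big _ p) big_filter big_mkcond /=.
by apply: ler_sum => x _; case: ifP.
Qed.

(** A duplicate-free list of pairs embeds into the product of its two projections, over which the
    sum factors. *)
Lemma ler_sum_pairs (T U : eqType) (F : T -> R) (G : U -> R) (s : seq (T * U)) :
  uniq s -> (forall x, 0 <= F x) -> (forall y, 0 <= G y) ->
  \sum_(p <- s) F p.1 * G p.2 <=
  (\sum_(x <- undup (map fst s)) F x) * \sum_(y <- undup (map snd s)) G y.
Proof.
move=> us F0 G0; set X := undup _; set Y := undup _.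
apply: (@le_trans _ _ (\sum_(p <- [seq (x, y) | x <- X, y <- Y]) F p.1 * G p.2)).
  apply: ler_sum_subseq => // [||p]; last by rewrite mulr_ge0.
    by apply: allpairs_uniq; rewrite ?undup_uniq // => -[x y] [x' y'].
  move=> [x y] sp; apply/allpairsP; exists (x, y).
  by rewrite !mem_undup; split => //=; apply/mapP; exists (x, y).
rewrite big_allpairs_dep big_distrl /=; apply: ler_sum => x _.
by rewrite big_distrr.
Qed.

(* Follows from exp u >= 1 + u at u = (c - 1) ln((n+2)/(n+1)) and
   ln((n+2)/(n+1)) >= 1/(n+2). *)
Lemma zeta_tail (c : R) (n : nat) : 1 < c ->
  (c - 1) * (n.+2%:R `^ c)^-1 <= n.+1%:R `^ (1 - c) - n.+2%:R `^ (1 - c).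
Proof.
move=> c1; have x0 : 0 < n.+1%:R :> R by rewrite ltr0n.
have y0 : 0 < n.+2%:R :> R by rewrite ltr0n.
have lnle : (n.+2%:R)^-1 <= ln (n.+2%:R / n.+1%:R : R).
  rewrite -[n.+2%:R / _]invrK lnV ?posrE ?invr_gt0 ?divr_gt0 // lerNr invf_div.
  have -> : n.+1%:R / n.+2%:R = 1 + - n.+2%:R^-1 :> R.
    by rewrite -[in n.+2%:R]natr1; field; rewrite gt_eqF // ltr_wpDl // addr_ge0.
  by apply: le_ln1Dx; rewrite ltrN2 invf_lt1 // ltr1n.
have -> : n.+1%:R `^ (1 - c) =
    n.+2%:R `^ (1 - c) * expR ((c - 1) * ln (n.+2%:R / n.+1%:R)) :> R.
  rewrite /powR (gt_eqF x0) (gt_eqF y0) -expRD; congr expR.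
  by rewrite ln_div ?posrE //; ring.
have -> : (n.+2%:R `^ c)^-1 = n.+2%:R `^ (1 - c) * n.+2%:R^-1 :> R.
  rewrite powRB; last by rewrite (gt_eqF y0) implybT.
  by rewrite powRr1 ?ltW // mulrAC divff ?mul1r // gt_eqF.
rewrite -[X in _ <= _ - X]mulr1 -mulrBr mulrCA ler_wpM2l ?powR_ge0 //.
rewrite lerBrDl; apply: le_trans (expR_ge1Dx _).
by rewrite lerD2l ler_wpM2l // subr_ge0 ltW.
Qed.

(** The integral-test bound for the zeta series: the first term plus the integral of x^(-c) over [1,
    +oo). *)
Definition zeta_bound (c : R) : R := 1 + (c - 1)^-1.

Lemma zeta_bound_ge1 (c : R) : 1 < c -> 1 <= zeta_bound c.
Proof. by move=> c1; rewrite lerDl invr_ge0 subr_ge0 ltW. Qed.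

(** The bounds of [zeta_tail] telescope; keeping the subtracted power in the statement is what lets
    the induction close. *)
Lemma zeta_partial (c : R) (n : nat) : 1 < c ->
  \sum_(0 <= j < n.+1) ((j%:R + 1) `^ c)^-1 <=
  1 + (c - 1)^-1 * (1 - n.+1%:R `^ (1 - c)).
Proof.
move=> c1; elim: n => [|n IH].
  by rewrite big_nat1 add0r !powR1 invr1 subrr mulr0 addr0.
rewrite big_nat_recr //= natr1; apply: le_trans (lerD IH (lexx _)) _.
have c0 : 0 < c - 1 by rewrite subr_gt0.
have := zeta_tail n c1; rewrite mulrC -ler_pdivlMr // => H.
apply: le_trans (lerD (lexx _) H) _.
by rewrite -addrA lerD2l [X in _ + X]mulrC -mulrDr ler_pM2l ?invr_gt0 // addrA subrK.
Qed.

Lemma zeta_uniq (c : R) (s : seq nat) : 1 < c -> uniq s ->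
  \sum_(j <- s) ((j%:R + 1) `^ c)^-1 <= zeta_bound c.
Proof.
move=> c1 us; pose N := \max_(j <- s) j.
have le1 : \sum_(j <- s) ((j%:R + 1) `^ c)^-1 <=
    \sum_(0 <= j < N.+1) ((j%:R + 1) `^ c)^-1 :> R.
  apply: ler_sum_subseq => [||j sj|j]; rewrite ?iota_uniq //.
    by rewrite mem_index_iota ltnS leq_bigmax_seq.
apply: le_trans le1 _; apply: le_trans (zeta_partial N c1) _.
by rewrite lerD2l ler_piMr ?invr_ge0 ?subr_ge0 ?(ltW c1) // gerBl powR_ge0.
Qed.

(** [absz] is injective on the nonnegative and on the negative integers separately, hence the factor
    2. *)
Lemma zeta_uniq_int (c : R) (s : seq int) : 1 < c -> uniq s ->
  \sum_(i <- s) (((absz i)%:R + 1) `^ c)^-1 <= 2 * zeta_bound c.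
Proof.
move=> c1 us; rewrite (bigID (fun i : int => 0 <= i)) /= mulr2n mulrDl !mul1r.
rewrite -!(big_filter s).
rewrite -!(big_map absz xpredT (fun j : nat => ((j%:R + 1) `^ c)^-1)).
apply: lerD; apply: zeta_uniq => //; rewrite map_inj_in_uniq ?filter_uniq //.
  by move=> i j; rewrite !mem_filter; lia.
by move=> i j; rewrite !mem_filter; lia.
Qed.

(** The first [m] triples are distinct and lie below the level [W] of the last one, so each pair [p]
    accounts for at most [W / w p] of them. Only pairs occurring in [S] enter the bound on the
    series, which allows weights that depend on a single coordinate. *)
Lemma rank_bound (S : set (int * nat * nat)%type) (h : R -> R -> R -> R)
    (phi : nat -> int * nat * nat) (w : int * nat -> R) (Z : R) :
  h_assignment h S phi ->
  (forall p, 0 < w p) ->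
  (forall s, S s -> criterion_at h s = w s.1 * s.2%:R) ->
  (forall P : seq (int * nat), uniq P ->
     (forall p, p \in P -> exists k, S (p, k)) -> \sum_(p <- P) (w p)^-1 <= Z) ->
  forall m, (0 < m)%N -> m%:R <= Z * w (phi m).1 * (phi m).2%:R.
Proof.
move=> [crit Sgrid _ [phiS phi_inj _] phi_sorted] w0 hw hZ m m0.
set W := w (phi m).1 * (phi m).2%:R.
have W0 : 0 <= W by rewrite mulr_ge0 // ltW.
pose L := [seq phi q | q <- iota 1 m].
pose P := undup (map fst L).
(* For a pair [p], the budgets k >= 1 with [w p] k <= [W] are exactly those from 1 to the truncation
   of [W / w p]. *)
pose box := [seq (p, k) | p <- P, k <- iota 1 (Num.truncn (W / w p))].
have uL : uniq L.
  rewrite map_inj_in_uniq ?iota_uniq // => q q'.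
  rewrite !mem_iota => /andP[q0 _] /andP[q0' _]; apply: phi_inj; exact: mem_set.
have LS s : s \in L -> S s.
  case/mapP => q; rewrite mem_iota => /andP[q0 _] ->; exact: phiS.
have Lbox : {subset L <= box}.
  move=> s Ls; have Ss := LS _ Ls; case/mapP: (Ls) => q.
  rewrite mem_iota => /andP[q0 qm] sE.
  apply/allpairsPdep; exists s.1, s.2; split; last by case: (s).
    by rewrite mem_undup map_f.
  rewrite mem_iota add1n ltnS (Sgrid _ Ss) /= truncn_ge_nat; last first.
    by rewrite divr_ge0 // ltW.
  rewrite ler_pdivlMr // mulrC -hw // sE /W -hw; last exact: phiS.
  by apply: phi_sorted => //; lia.
have := uniq_leq_size uL Lbox.
rewrite size_allpairs_dep size_map size_iota -(ler_nat R) => /le_trans; apply.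
rewrite sumnE big_map natr_sum -mulrA -/W mulrC.
apply: (@le_trans _ _ (\sum_(p <- P) W * (w p)^-1)).
  apply: ler_sum => p _; rewrite size_iota truncn_le.
  by rewrite divr_ge0 // ltW.
rewrite -mulr_sumr ler_wpM2l // hZ ?undup_uniq // => p.
rewrite mem_undup => /mapP[s Ls ->]; exists s.2.
by rewrite -surjective_pairing; exact: LS.
Qed.

End Counting.

(** * Rounding of alpha and beta to the grid, and the radius at a grid point *)

Section Grid.
Context {R : realType}.

Lemma powRz_ln (a x : R) : 1 < a -> 0 < x -> a `^ (ln x / ln a) = x.
Proof.
move=> a1 x0; have la := ln_gt0 a1.
by rewrite /powR gt_eqF ?(lt_trans ltr01) // divfK ?gt_eqF // lnK.
Qed.

Lemma alpha_star_gt0 (a alpha0 alpha : R) : 1 < a -> 0 < alpha0 ->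
  0 < alpha_star a alpha0 alpha.
Proof. by move=> a1 h0; rewrite mulr_gt0 // exprz_gt0 // (lt_trans ltr01). Qed.

Lemma alpha_star_le (a alpha0 alpha : R) : 1 < a -> 0 < alpha0 -> 0 < alpha ->
  alpha_star a alpha0 alpha <= alpha.
Proof.
move=> a1 h0 h; have a0 := lt_trans ltr01 a1.
rewrite /alpha_star -ler_pdivlMr // -powR_intmul ?(ltW a0) //.
rewrite -[X in _ <= X](powRz_ln a1) ?divr_gt0 //.
by apply: ler_powR; rewrite ?(ltW a1) // floor_le.
Qed.

Lemma beta_star_ge (b beta0 beta : R) : 1 < b -> 0 < beta0 -> 0 < beta ->
  beta <= beta_star b beta0 beta.
Proof.
move=> b1 h0 h; have b0 := lt_trans ltr01 b1.
rewrite /beta_star -ler_pdivrMr // -powR_intmul ?(ltW b0) //.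
rewrite -[X in X <= _](powRz_ln b1) ?divr_gt0 //.
by apply: ler_powR; rewrite ?(ltW b1) // ceil_ge.
Qed.

(** Rounding the exponent up adds less than one, so at most one extra factor [b] appears. *)
Lemma beta_star_le (b beta0 beta : R) : 1 < b -> 0 < beta0 -> 0 < beta ->
  beta_star b beta0 beta <= b * beta.
Proof.
move=> b1 h0 h; have b0 := lt_trans ltr01 b1.
rewrite /beta_star -ler_pdivlMr // -powR_intmul ?(ltW b0) // -mulrA.
rewrite -[X in _ <= _ * X](powRz_ln b1) ?divr_gt0 // -[X in _ <= X * _]powRr1 ?(ltW b0) //.
rewrite -powRD; last by rewrite (gt_eqF b0) implybT.
apply: ler_powR; first exact: ltW.
have := ceilB1_lt (ln (beta / beta0) / ln b).
by rewrite intrB => /ltW; rewrite lerBlDl.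
Qed.

Lemma ceil_log_ge0 (b beta0 beta : R) : 1 < b -> 0 < beta0 -> beta0 <= beta ->
  0 <= Num.ceil (ln (beta / beta0) / ln b).
Proof.
move=> b1 h0 h; rewrite ceil_ge0 (lt_le_trans (ltrN10 _)) //.
by rewrite divr_ge0 ?ln_ge0 ?(ltW b1) // ler_pdivlMr // mul1r.
Qed.

(** Since [beta0 <= beta], the rounded exponent is nonnegative, so it is a legitimate second index
    of the grid. *)
Lemma beta_starE (b beta0 beta : R) : 1 < b -> 0 < beta0 -> beta0 <= beta ->
  beta_star b beta0 beta = b ^+ absz (Num.ceil (ln (beta / beta0) / ln b)) * beta0.
Proof.
by move=> b1 h0 h; rewrite /beta_star -[in LHS](gez0_abs (ceil_log_ge0 b1 h0 h)).
Qed.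

Lemma radius_gt0 (a b alpha0 beta0 : R) (i : int) (j : nat) (e : R) :
  0 < a -> 0 < alpha0 -> 0 < e -> 0 < Defs.radius a b alpha0 beta0 i j e.
Proof.
move=> a0 h0 e0; have B : 0 < 2 * e / (a ^ i * alpha0).
  by rewrite divr_gt0 ?mulr_gt0 ?exprz_gt0.
by rewrite /Defs.radius; case: ifP => _; exact: powR_gt0.
Qed.

(** The max and the min in [star_radius] encode the two branches of [radius]: in each branch one of
    the factors has base 1. *)
Lemma radius_star (a b r alpha0 beta0 eps0 : R) (i : int) (j u : nat) :
  0 < a -> 0 < alpha0 ->
  Defs.radius a b alpha0 beta0 i j (r ^+ u * eps0) =
  star_radius b r beta0 eps0 (a ^ i * alpha0) (b ^+ j * beta0) u.+1.
Proof.
move=> a0 h0; have A0 : 0 < a ^ i * alpha0 by rewrite mulr_gt0 ?exprz_gt0.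
rewrite /Defs.radius /star_radius /= mulrA; set y := 2 * r ^+ u * eps0.
case: ltP => hy.
  have y1 : 1 <= y / (a ^ i * alpha0) by rewrite ler_pdivlMr // mul1r ltW.
  by rewrite (max_r y1) (min_l y1) powR1 mulr1.
have y1 : y / (a ^ i * alpha0) <= 1 by rewrite ler_pdivrMr // mul1r.
by rewrite (max_l y1) (min_r y1) powR1 [RHS]mul1r.
Qed.

(* Where 2e exceeds alpha_i the exponent 1/beta is majorized by both
   b/beta_j and 1/beta0; elsewhere it is minorized by 1/beta_j. *)
Lemma sharp_radius (a b alpha alpha0 beta beta0 e y : R) (i : int) (j : nat) :
  0 < a -> 0 < alpha0 -> a ^ i * alpha0 <= alpha ->
  0 < beta0 -> beta0 <= beta -> beta <= b ^+ j * beta0 <= b * beta ->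
  0 <= y -> y <= 2 * e -> 0 < e ->
  (y / alpha) `^ (1 / beta) <= Defs.radius a b alpha0 beta0 i j e.
Proof.
move=> a0 al0 ale b0 b0b /andP[bbs bsb] y0 ye e0.
have be0 := lt_le_trans b0 b0b.
have bs0 := lt_le_trans be0 bbs.
have A0 : 0 < a ^ i * alpha0 by rewrite mulr_gt0 ?exprz_gt0.
have al : 0 < alpha by exact: lt_le_trans ale.
have e20 : 0 < 2 * e by rewrite mulr_gt0.
have base : y / alpha <= 2 * e / (a ^ i * alpha0).
  apply: ler_pM; rewrite ?invr_ge0 ?(ltW al) //.
  by rewrite lef_pV2.
have base0 : 0 < 2 * e / (a ^ i * alpha0) by rewrite divr_gt0.
apply: (@le_trans _ _ ((2 * e / (a ^ i * alpha0)) `^ (1 / beta))).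
  by apply: ge0_ler_powR; rewrite ?nnegrE ?(ltW base0) ?divr_ge0 ?(ltW be0) ?(ltW al).
rewrite /Defs.radius; case: ltP => hy.
  apply: ler_powR; first by rewrite ler_pdivlMr // mul1r ltW.
  rewrite le_min !mul1r lef_pV2 // b0b andbT.
  by rewrite ler_pdivlMr // mulrC ler_pdivrMr.
apply: ger_powR; first by rewrite base0 ler_pdivrMr // mul1r.
by rewrite !mul1r lef_pV2.
Qed.

End Grid.

(** * Invariant of a run, followed at one fixed grid point [(i, j)] *)

Section Run.
Context {R : realType} {n : nat}.
Variables (D Q : set (Cn R n)) (f g : Cn R n -> R) (d : Cn R n -> Cn R n -> R).
Variables (Gamma : R -> R -> Cn R n -> Cn R n).
Variables (iters : R -> R -> Cn R n -> nat) (cost : R -> R -> nat).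
Variables (phi : nat -> int * nat * nat).
Variables (a b r alpha0 beta0 eps0 eta : R) (x0 : Cn R n) (i : int) (j : nat).

Hypothesis method : first_order_method D f Q g d Gamma iters cost.
Hypothesis a_gt0 : 0 < a.
Hypothesis r_gt0 : 0 < r.
Hypothesis alpha0_gt0 : 0 < alpha0.
Hypothesis eps0_gt0 : 0 < eps0.
Hypothesis x0_dom : D x0.
Hypothesis x0_gap : total_gap f Q g x0 <= eps0.

(** The factor 2 comes from a gap that is at most [e] but larger than [eta]: then gap + [eta] is at
    most 2[e]. *)
Hypothesis good_radius : forall x e, D x -> 0 < e ->
  total_gap f Q g x + eta <= 2 * e ->
  dist_to d x (minimizers f Q) <= Defs.radius a b alpha0 beta0 i j e.

(** Budgets at [(i, j)] are reached one at a time, starting from 1; hence the indices [k.+2] and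
    [k.+1]. *)
Hypothesis phi_pred : forall q k, (0 < q)%N -> phi q = (i, j, k.+2) ->
  exists2 q', (0 < q' < q)%N & phi q' = (i, j, k.+1).

Definition unit_cost (q : nat) : nat :=
  cost (star_radius b r beta0 eps0 (a ^ i * alpha0) (b ^+ j * beta0) q)
       (r ^+ q * eps0).

Definition cumulative_cost (u : nat) : nat := (\sum_(1 <= q < u.+1) unit_cost q)%N.

Lemma cumulative_costS u :
  cumulative_cost u.+1 = (cumulative_cost u + unit_cost u.+1)%N.
Proof. by rewrite /cumulative_cost big_nat_recr. Qed.

Lemma unit_costE u : unit_cost u.+1 =
  cost (Defs.radius a b alpha0 beta0 i j (r ^+ u * eps0)) (r * (r ^+ u * eps0)).
Proof. by rewrite /unit_cost radius_star // exprS mulrA. Qed.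

Lemma accuracy_gt0 u : 0 < r ^+ u * eps0.
Proof. by rewrite mulr_gt0 ?exprn_gt0. Qed.

Lemma unit_cost_gt0 u : (0 < unit_cost u.+1)%N.
Proof.
rewrite unit_costE; have e0 := accuracy_gt0 u.
by apply: (cost_gt0 method); [exact: radius_gt0|exact: mulr_gt0].
Qed.

Lemma leq_cumulative_cost : {homo cumulative_cost : u v / (u <= v)%N}.
Proof.
by apply: homo_leq => // [? ? ?|u]; [exact: leq_trans|rewrite cumulative_costS leq_addr].
Qed.

(** [inv_accuracy] ranges over all grid points because a restart anywhere must be called with
    positive arguments to stay in [D]. [inv_budget] says that no budget processed so far at [(i, j)]
    pays for one restart more than those already made. *)
Record run_invariant (m : nat) (st : state (R := R) (n := n)) : Prop := {
  inv_dom : D (iterate st) ;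
  inv_accuracy : forall i' j',
    accuracy st i' j' (used st i' j') = r ^+ used st i' j' * eps0 ;
  inv_spent : spent st i j = cumulative_cost (used st i j) ;
  inv_gap : total_gap f Q g (iterate st) <=
    Num.max eta (r ^+ used st i j * eps0) ;
  inv_budget : forall q k, (0 < q <= m)%N -> phi q = (i, j, k) ->
    (k < cumulative_cost (used st i j).+1)%N }.

Lemma run_invariant_init st : restart_init eps0 x0 st -> run_invariant 0 st.
Proof.
move=> [it us sp acc]; split => [|i' j'||| q k].
- by rewrite it.
- by rewrite us acc mul1r.
- by rewrite us sp /cumulative_cost big_geq.
- by rewrite it us mul1r le_max x0_gap orbT.
- by case: q.
Qed.

Lemma total_gap_le x y : f x + g x <= f y + g y ->
  total_gap f Q g x <= total_gap f Q g y.
Proof. by rewrite /total_gap; lra. Qed.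

(** If the gap already is at most [eta], the old point serves; otherwise the gap is at most the
    current accuracy, the radius is valid, and the new point serves. The minimum appears because the
    scheme keeps the better of the two. *)
Lemma method_gap x u : D x ->
  total_gap f Q g x <= Num.max eta (r ^+ u * eps0) ->
  let delta := Defs.radius a b alpha0 beta0 i j (r ^+ u * eps0) in
  Num.min (total_gap f Q g x)
    (total_gap f Q g (Gamma delta (r * (r ^+ u * eps0)) x)) <=
  Num.max eta (r ^+ u.+1 * eps0).
Proof.
move=> Dx gapx /=; rewrite ge_min !le_max.
have [//|etax] := boolP (_ <= eta).
have e0 := accuracy_gt0 u.
move: gapx; rewrite le_max (negbTE etax) /= => gapx.
suff -> : total_gap f Q g (Gamma (Defs.radius a b alpha0 beta0 i j (r ^+ u * eps0))
    (r * (r ^+ u * eps0)) x) <= r ^+ u.+1 * eps0 by rewrite !orbT.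
rewrite exprS -mulrA; apply: (method_accuracy method) => //.
- exact: radius_gt0.
- exact: mulr_gt0.
apply: good_radius => //; move: etax; rewrite -ltNge; lra.
Qed.

Lemma run_invariant_step m st st' :
  restart_step f g Gamma cost phi a b r alpha0 beta0 m st st' ->
  run_invariant m st -> run_invariant m.+1 st'.
Proof.
rewrite /restart_step; case E : (phi m.+1) => [[i' j'] k'] [accE].
set e := accuracy st i' j' _ in accE *; set delta := Defs.radius _ _ _ _ _ _ _.
move=> H [dom acc sp gap bud].
have eE : e = r ^+ used st i' j' * eps0 by exact: acc.
have e0 : 0 < e by rewrite eE accuracy_gt0.
move: H; case: ifP => [fits [it lez lex spE usE]|nofit [it spE usE]]; last first.
  split => [|i2 j2|||q k]; rewrite ?it ?spE ?usE //.
    (* A refused restart still writes the entry U+1 of the accuracy table, whereas the entry read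
       here is U. *)
    rewrite accE /update3; case: (eqVneq i2 i') => [->|_] /=; last exact: acc.
    case: (eqVneq j2 j') => [->|_] /=; last exact: acc.
    by rewrite ltn_eqF ?acc.
  case/andP=> q0; rewrite leq_eqVlt => /orP[/eqP -> phiq|]; last first.
    by rewrite ltnS => qm; apply: bud; rewrite q0.
  (* The refusal inequality is itself the budget bound for the newly processed triple. *)
  move: E; rewrite phiq => -[? ? ?]; subst i' j' k'; move: nofit.
  rewrite /delta eE sp -unit_costE -cumulative_costS => /negbT.
  by rewrite -ltnNge.
have dl0 : 0 < delta by exact: radius_gt0.
have dom' : D (iterate st').
  by case: it => ->//; apply: (method_dom method); rewrite ?mulr_gt0.
have acc' i2 j2 :
    accuracy st' i2 j2 (used st' i2 j2) = r ^+ used st' i2 j2 * eps0.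
  rewrite accE usE /update2 /update3.
  case: (eqVneq i2 i') => [->|_] /=; last exact: acc.
  case: (eqVneq j2 j') => [->|_] /=; last exact: acc.
  by rewrite eqxx eE exprS mulrA.
(* A restart accepted at another grid point leaves the tables at [(i, j)] alone and does not
   increase the gap. *)
have [ij|ij] := boolP ((i == i') && (j == j')); last first.
  have us2 : used st' i j = used st i j by rewrite usE /update2 (negbTE ij).
  split; rewrite ?us2 //.
  - by rewrite spE /update2 (negbTE ij).
  - exact: le_trans (total_gap_le lex) gap.
  - move=> q k /andP[q0]; rewrite leq_eqVlt => /orP[/eqP -> phiq|]; last first.
      by rewrite ltnS => qm; apply: bud; rewrite q0.
    by move: ij; move: E; rewrite phiq => -[-> -> _]; rewrite !eqxx.
case/andP: ij => /eqP ii' /eqP jj'; subst i' j'.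
have us2 : used st' i j = (used st i j).+1 by rewrite usE /update2 !eqxx.
have costE : cost delta (r * e) = unit_cost (used st i j).+1.
  by rewrite unit_costE /delta eE.
split; rewrite ?us2 //.
- by rewrite spE /update2 !eqxx /= costE sp cumulative_costS.
- have := method_gap dom gap; rewrite /= -eE -/delta ge_min => /orP[|] H.
    exact: le_trans (total_gap_le lex) H.
  exact: le_trans (total_gap_le lez) H.
have lt2 : (cumulative_cost (used st i j).+1 < cumulative_cost (used st i j).+2)%N.
  by rewrite [X in (_ < X)%N]cumulative_costS -addn1 leq_add2l unit_cost_gt0.
move=> q k /andP[q0]; rewrite leq_eqVlt => /orP[/eqP -> phiq|]; last first.
  by rewrite ltnS => qm phiq; apply: ltn_trans lt2; apply: (bud q); rewrite ?q0.
(* The budget k - 1 was already processed and refused the next restart, so a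
   restart that fits in k uses it up exactly. *)
apply: leq_ltn_trans lt2; case: k phiq => [//|[_|k phiq]].
  by rewrite cumulative_costS addn_gt0 unit_cost_gt0 orbT.
have [//|q' /andP[q'0 q'm] phiq'] := phi_pred _ phiq.
by apply: (bud q'); rewrite // q'0.
Qed.

Lemma run_invariant_run t s :
  restart_run f g Gamma cost phi a b r alpha0 beta0 eps0 x0 t s ->
  forall m, (m <= t)%N -> run_invariant m (s m).
Proof.
move=> [init step]; elim=> [_|m IH mt]; first exact: run_invariant_init.
by apply: run_invariant_step (step _ mt) (IH (ltnW mt)).
Qed.

(** With fewer than [p] restarts made, the processed budget [cumulative_cost p] would have paid for
    one more, against [inv_budget]. *)
Lemma run_gap t s p m : (0 < m <= t)%N -> phi m = (i, j, cumulative_cost p) ->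
  restart_run f g Gamma cost phi a b r alpha0 beta0 eps0 x0 t s -> r <= 1 ->
  total_gap f Q g (iterate (s t)) <= Num.max eta (r ^+ p * eps0).
Proof.
move=> mt phim run r1; have inv := run_invariant_run run (leqnn t).
have pU : (p <= used (s t) i j)%N.
  rewrite leqNgt; apply/negP => /leq_cumulative_cost.
  by rewrite leqNgt (inv_budget inv mt phim).
apply: le_trans (inv_gap inv) _; rewrite ge_max !le_max lexx /=.
apply/orP; right; rewrite ler_pM2r //.
by apply: ler_wiXn2l => //; exact: ltW.
Qed.

End Run.

(** * Number of restarts and growth of the total cost as the accuracy tends to 0 *)

Section CostEstimate.
Context {R : realType}.

Lemma restart_countE (r eps0 e : R) : 0 < r < 1 -> 0 < e < eps0 ->
  (restart_count r eps0 e)%:R =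
  (Num.ceil (ln (eps0 / e) / ln (1 / r)))%:~R :> R /\
  (0 < restart_count r eps0 e)%N.
Proof.
move=> /andP[r0 r1] /andP[e0 ee].
have c0 : 0 < Num.ceil (ln (eps0 / e) / ln (1 / r)).
  rewrite ceil_gt0 divr_gt0 // ln_gt0 // ltr_pdivlMr // ?mul1r //.
rewrite /restart_count; split; last by rewrite absz_gt0 gt_eqF.
by rewrite natr_absz gtr0_norm.
Qed.

Lemma ln_restart (r eps0 : R) (p : nat) : 0 < r -> 0 < eps0 ->
  ln (r ^+ p * eps0) = ln eps0 - p%:R * ln (1 / r).
Proof.
move=> r0 e0; rewrite lnM ?posrE ?exprn_gt0 // lnXn // div1r lnV ?posrE //.
by rewrite -mulr_natl; ring.
Qed.

Lemma ln_inv_gt0 (r : R) : 0 < r < 1 -> 0 < ln (1 / r).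
Proof. by move=> /andP[r0 r1]; rewrite ln_gt0 // ltr_pdivlMr // mul1r. Qed.

Lemma restart_count_le (r eps0 e : R) : 0 < r < 1 -> 0 < e < eps0 ->
  r ^+ restart_count r eps0 e * eps0 <= e.
Proof.
move=> rr ee; have [pE _] := restart_countE rr ee; have L0 := ln_inv_gt0 rr.
case/andP: rr ee => r0 r1 /andP[e0 ee]; have eps00 := lt_trans e0 ee.
rewrite -ler_ln ?posrE ?mulr_gt0 ?exprn_gt0 // ln_restart //.
rewrite lerBlDr addrC -lerBlDr -ln_div ?posrE // -ler_pdivrMr // pE.
exact: ceil_ge.
Qed.

Lemma restart_count_lt (r eps0 e : R) : 0 < r < 1 -> 0 < e < eps0 ->
  (restart_count r eps0 e)%:R < ln (eps0 / e) / ln (1 / r) + 1.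
Proof.
move=> rr ee; have [-> _] := restart_countE rr ee.
by rewrite -ltrBlDr; have := ceilB1_lt (ln (eps0 / e) / ln (1 / r)); rewrite intrB.
Qed.

(** The ceiling exceeds its argument by less than one, so the last accuracy undershoots [e] by at
    most one factor [r]. *)
Lemma restart_count_ge (r eps0 e : R) : 0 < r < 1 -> 0 < e < eps0 ->
  r * e <= r ^+ restart_count r eps0 e * eps0.
Proof.
move=> rr ee; have lt := restart_count_lt rr ee; have L0 := ln_inv_gt0 rr.
case/andP: rr ee => r0 r1 /andP[e0 ee]; have eps00 := lt_trans e0 ee.
rewrite -ler_ln ?posrE ?mulr_gt0 ?exprn_gt0 // ln_restart //.
have -> : ln (r * e) = ln e - ln (1 / r).
  by rewrite lnM ?posrE // div1r lnV ?posrE //; ring.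
move: lt; rewrite -ltrBlDr ltr_pdivlMr // ln_div ?posrE // mulrBl mul1r; lra.
Qed.

Lemma star_radius_gt0 (b r beta0 eps0 alphas betas : R) (q : nat) :
  0 < r -> 0 < eps0 -> 0 < alphas ->
  0 < star_radius b r beta0 eps0 alphas betas q.
Proof.
move=> r0 e0 a0; rewrite /star_radius mulr_gt0 // powR_gt0 //.
  by rewrite lt_max ltr01.
by rewrite lt_min ltr01 divr_gt0 // mulr_gt0 // mulr_gt0 // exprn_gt0.
Qed.

(** The part of the radius bound independent of the restart: the max factor is taken at its largest
    value, that of the first restart. The division by [r] arises because a radius is computed from
    the accuracy preceding the one requested. *)
Definition radius_factor (b r beta0 eps0 alphas betas : R) : R :=
  Num.max 1 (2 * eps0 / alphas) `^ Num.min (b / betas) (1 / beta0) *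
  (2 / (alphas * r)) `^ (1 / betas).

Lemma star_radius_le (b r beta0 eps0 alphas betas : R) (q : nat) :
  0 < b -> 0 < r < 1 -> 0 < beta0 -> 0 < eps0 -> 0 < alphas -> 0 < betas ->
  star_radius b r beta0 eps0 alphas betas q.+1 <=
  radius_factor b r beta0 eps0 alphas betas * (r ^+ q.+1 * eps0) `^ (1 / betas).
Proof.
move=> b0 /andP[r0 r1] be0 e0 a0 bs0.
rewrite /star_radius /radius_factor -[X in _ <= X]mulrA -powRM; last 2 first.
- by rewrite divr_ge0 // ltW // mulr_gt0.
- by rewrite ltW // mulr_gt0 // exprn_gt0.
have -> : 2 / (alphas * r) * (r ^+ q.+1 * eps0) = 2 * r ^+ q * eps0 / alphas.
  by rewrite exprS; field; rewrite !gt_eqF.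
set y := 2 * r ^+ q.+1.-1 * eps0 / alphas.
have y0 : 0 < y by rewrite divr_gt0 // mulr_gt0 // mulr_gt0 // exprn_gt0.
have yle : y <= 2 * eps0 / alphas.
  rewrite ler_pM2r ?invr_gt0 // ler_pM2r // ler_piMr //.
  by apply: exprn_ile1; exact: ltW.
have max0 z : 0 <= Num.max 1 z :> R by rewrite le_max ler01.
apply: ler_pM; rewrite ?powR_ge0 //.
  apply: ge0_ler_powR; rewrite ?nnegrE //.
    by rewrite le_min !divr_ge0 // ltW.
  by rewrite ge_max !le_max lexx yle orbT.
apply: ge0_ler_powR; rewrite ?nnegrE ?(ltW y0) //.
- by rewrite divr_ge0 // ltW.
- by rewrite le_min ler01 ltW.
- by rewrite ge_min lexx orbT.
Qed.

(** The conditional accounts for the extreme accuracy, [eps0 ^ (- theta)] absorbs the additive 1 in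
    the cost bound, and the last factor converts the number of restarts into the ceiling of the
    logarithm. *)
Definition cost_factor (r a b alpha betas alpha0 beta0 d1 d2 C eps0 : R) : R :=
  let theta := d1 / betas - d2 in
  (C * radius_factor b r beta0 eps0 (alpha_star a alpha0 alpha) betas `^ d1 *
     (if d2 <= d1 / betas then 1 else r `^ theta) + eps0 `^ (- theta)) *
  ((ln (1 / r))^-1 + 1).

Lemma cost_power_le (C B delta x d1 d2 betas : R) :
  0 < C -> 0 <= B -> 0 <= delta -> 0 < x -> 0 < d1 ->
  delta <= B * x `^ (1 / betas) ->
  C * delta `^ d1 / x `^ d2 <= C * B `^ d1 * x `^ (d1 / betas - d2).
Proof.
move=> C0 B0 de0 x0 d10 le_de.
have Bx0 : 0 <= B * x `^ (1 / betas) by rewrite mulr_ge0 ?powR_ge0.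
rewrite powRB; last by rewrite (gt_eqF x0) implybT.
rewrite mulrA; apply: ler_wpM2r; first by rewrite invr_ge0 powR_ge0.
rewrite -mulrA; apply: ler_wpM2l; first exact: ltW.
have -> : d1 / betas = 1 / betas * d1 by rewrite mulrC div1r.
rewrite powRrM -powRM ?powR_ge0 //.
by apply: ge0_ler_powR; rewrite ?nnegrE ?(ltW d10).
Qed.

(** All summands admit one common bound, so the total is at most that bound times the number of
    restarts. *)
Lemma total_cost_le (cost : R -> R -> nat)
    (r a b alpha betas alpha0 beta0 d1 d2 C eps0 e : R) :
  0 < C -> 0 < d1 ->
  (forall delta eps : R, 0 < delta -> 0 < eps ->
    (cost delta eps)%:R <= C * delta `^ d1 / eps `^ d2 + 1) ->
  1 < a -> 0 < b -> 0 < r < 1 -> 0 < beta0 -> 0 < alpha0 -> 0 < betas ->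
  0 < e < eps0 ->
  (total_cost cost b r beta0 eps0 (alpha_star a alpha0 alpha) betas e)%:R <=
  cost_factor r a b alpha betas alpha0 beta0 d1 d2 C eps0 *
    (if d2 <= d1 / betas
     then eps0 `^ (d1 / betas - d2) * (Num.ceil (ln (eps0 / e)))%:~R
     else e `^ (d1 / betas - d2) * (Num.ceil (ln (eps0 / e)))%:~R).
Proof.
move=> C0 d10 hc a1 b0 rr be0 al0 bs0 ee.
have [r0 r1] := andP rr; have [e0 elt] := andP ee; have eps00 := lt_trans e0 elt.
have as0 := alpha_star_gt0 alpha a1 al0; set as_ := alpha_star _ _ _ in as0 *.
rewrite /cost_factor -/as_; set theta := d1 / betas - d2.
set B := radius_factor _ _ _ _ _ _; set p := restart_count r eps0 e.
set N := (Num.ceil _)%:~R.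
have -> : (if d2 <= d1 / betas then eps0 `^ theta * N else e `^ theta * N) =
    (if d2 <= d1 / betas then eps0 else e) `^ theta * N by case: ifP.
set W := (if _ then eps0 else e) `^ theta.
have B0 : 0 <= B by rewrite mulr_ge0 ?powR_ge0.
have A0 : 0 <= C * B `^ d1 by rewrite mulr_ge0 ?powR_ge0 // ltW.
set E := if _ then 1 else r `^ theta.
have E0 : 0 <= E by rewrite /E; case: ifP => // _; exact: powR_ge0.
have powN z : z `^ theta = (z `^ (- theta))^-1 by rewrite -powRN opprK.
have term q : (0 < q <= p)%N ->
    (cost (star_radius b r beta0 eps0 as_ betas q) (r ^+ q * eps0))%:R <=
    (C * B `^ d1 * E + eps0 `^ (- theta)) * W.
  case: q => // q /andP[_ qp].
  have x0 : 0 < r ^+ q.+1 * eps0 by rewrite mulr_gt0 ?exprn_gt0.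
  apply: le_trans (hc _ _ (star_radius_gt0 _ _ _ _ r0 eps00 as0) x0) _.
  rewrite mulrDl; apply: lerD.
    apply: (@le_trans _ _ (C * B `^ d1 * (r ^+ q.+1 * eps0) `^ theta)).
      apply: cost_power_le => //; first by rewrite ltW // star_radius_gt0.
      exact: star_radius_le.
    rewrite -[leRHS]mulrA ler_wpM2l // /E /W; case: ifP => hd.
      rewrite mul1r; apply: ge0_ler_powR; rewrite ?nnegrE ?subr_ge0 ?(ltW x0) ?(ltW eps00) //.
      by rewrite ler_piMl ?(ltW eps00) // exprn_ile1 // ltW.
    (* Here [theta] is negative, so the smallest accuracy is the worst one, and it is at least
       [r * e]. *)
    rewrite -powRM ?(ltW r0) ?(ltW e0) // !powN.
    rewrite lef_pV2 ?posrE ?powR_gt0 ?(mulr_gt0 r0 e0) //.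
    apply: ge0_ler_powR; rewrite ?nnegrE ?(ltW x0) ?mulr_ge0 ?(ltW r0) ?(ltW e0) //.
      by rewrite oppr_ge0 subr_le0 ltW // ltNge hd.
    apply: le_trans (restart_count_ge rr ee) _; rewrite ler_pM2r //.
    by apply: ler_wiXn2l => //; exact: ltW.
  (* The additive 1: the product of [eps0 ^ (- theta)] and [W] equals 1 in the first case and is at
     least 1 in the second, where [e < eps0]. *)
  rewrite /W; case: ifP => hd.
    by rewrite powRN mulVf // gt_eqF // powR_gt0.
  rewrite (powN e) ler_pdivlMr ?powR_gt0 // mul1r.
  apply: ge0_ler_powR; rewrite ?nnegrE ?(ltW e0) ?(ltW eps00) ?(ltW elt) //.
  by rewrite oppr_ge0 subr_le0 ltW // ltNge hd.
set Cc := _ + eps0 `^ _ in term *.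
have Cc0 : 0 <= Cc by rewrite addr_ge0 ?powR_ge0 // mulr_ge0.
have W0 : 0 <= W by exact: powR_ge0.
have L0 := ln_inv_gt0 rr.
(* This lets [N] absorb the 1 lost in rounding up the number of restarts. *)
have N1 : 1 <= N.
  by rewrite ler1z -gtz0_ge1 ceil_gt0 ln_gt0 // ltr_pdivlMr // mul1r.
apply: (@le_trans _ _ (p%:R * (Cc * W))).
  rewrite natr_sum -/p.
  have -> : p%:R * (Cc * W) = \sum_(1 <= q < p.+1) Cc * W.
    by rewrite sumr_const_nat subSS subn0 mulr_natl.
  by apply: ler_sum_nat => q; rewrite ltnS; exact: term.
have -> : Cc * ((ln (1 / r))^-1 + 1) * (W * N) =
    N * ((ln (1 / r))^-1 + 1) * (Cc * W) by ring.
rewrite ler_wpM2r ?mulr_ge0 // (le_trans (ltW (restart_count_lt rr ee))) //.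
by rewrite mulrDr mulr1 lerD // ler_pM2r ?invr_gt0 // ceil_ge.
Qed.

End CostEstimate.

(** * The three schedules: the rank is linear in the budget, and budgets come in increasing order *)

Section Schedules.
Context {R : realType}.

Lemma zeta_uniq_pair (c1 c2 : R) (P : seq (int * nat)) :
  1 < c1 -> 1 < c2 -> uniq P ->
  \sum_(p <- P) (((absz p.1)%:R + 1) `^ c1 * (p.2%:R + 1) `^ c2)^-1 <=
  2 * zeta_bound c1 * zeta_bound c2.
Proof.
move=> c11 c21 uP; under eq_bigr do rewrite invfM.
apply: le_trans (ler_sum_pairs (F := fun i : int => (((absz i)%:R + 1) `^ c1)^-1)
  (G := fun j : nat => ((j%:R + 1) `^ c2)^-1) uP _ _) _ => [?|?|].
- by rewrite invr_ge0 powR_ge0.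
- by rewrite invr_ge0 powR_ge0.
apply: ler_pM; rewrite ?zeta_uniq ?zeta_uniq_int ?undup_uniq //.
  by apply: sumr_ge0 => ? _; rewrite invr_ge0 powR_ge0.
by apply: sumr_ge0 => ? _; rewrite invr_ge0 powR_ge0.
Qed.

(** Rounding fixes a value already on the grid, so for known alpha the rounded index is the one that
    defines [S]. *)
Lemma floor_log_exprz (a alpha0 : R) (i : int) : 1 < a -> 0 < alpha0 ->
  Num.floor (ln (a ^ i * alpha0 / alpha0) / ln a) = i.
Proof.
move=> a1 al0; rewrite mulfK ?gt_eqF // -powR_intmul; last first.
  by rewrite ltW // (lt_trans ltr01).
by rewrite ln_powR mulfK ?gt_eqF ?ln_gt0 // intrKfloor.
Qed.

(** Each case supplies its weight and series bound to [rank_bound]. When alpha or beta is known, the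
    pairs of [S] share one coordinate, so projecting to the other is injective and a single series
    suffices. *)
Lemma schedule_rank (S : set (int * nat * nat)%type) (h : R -> R -> R -> R)
    (phi : nat -> int * nat * nat) (a b alpha0 beta0 alpha beta : R) :
  1 < a -> 0 < alpha0 -> 0 < beta0 ->
  [\/ unknown_alpha_beta S h, known_alpha a alpha0 alpha S h
    | known_beta beta0 beta S h] ->
  h_assignment h S phi ->
  let i := Num.floor (ln (alpha / alpha0) / ln a) in
  let j := absz (Num.ceil (ln (beta / beta0) / ln b)) in
  (forall k, (0 < k)%N -> S (i, j, k)) /\
  exists2 c : R, 0 < c & forall m k, (0 < m)%N -> phi m = (i, j, k) ->
    m%:R <= c * k%:R.
Proof.
move=> a1 al0 be0 cases hphi i j.
have pow1 (x : nat) (c : R) : 0 < (x%:R + 1) `^ c :> R.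
  by rewrite powR_gt0 // ltr_wpDl.
have zb (c : R) : 1 < c -> 0 < zeta_bound c.
  by move=> c1; apply: lt_le_trans (zeta_bound_ge1 c1).
have Sgrid := assignment_grid hphi.
have conclude (w : int * nat -> R) (Z : R) : 0 < Z -> (forall p, 0 < w p) ->
    (forall s, S s -> criterion_at h s = w s.1 * s.2%:R) ->
    (forall P : seq (int * nat), uniq P ->
      (forall p, p \in P -> exists k, S (p, k)) -> \sum_(p <- P) (w p)^-1 <= Z) ->
    exists2 c : R, 0 < c & forall m k, (0 < m)%N -> phi m = (i, j, k) ->
      m%:R <= c * k%:R.
  move=> Z0 w0 hw hZ; exists (Z * w (i, j)); first by rewrite mulr_gt0.
  by move=> m k m0 phim; have := rank_bound hphi w0 hw hZ m0; rewrite phim.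
case: cases => [[SE [c1 [c2 [c11 c21 hE]]]]|[i' [alE SE] [c2 c21 hE]]|[beE SE [c1 c11 hE]]].
- split; first by move=> k k0; rewrite SE.
  apply: (conclude (fun p => ((absz p.1)%:R + 1) `^ c1 * (p.2%:R + 1) `^ c2)
    (2 * zeta_bound c1 * zeta_bound c2)) => [|p|s /Sgrid s0|P uP _].
  + by rewrite !mulr_gt0 ?zb.
  + by rewrite mulr_gt0.
  + by rewrite /criterion_at hE // ltr0n.
  + exact: zeta_uniq_pair.
- have ii' : i = i' by rewrite /i alE floor_log_exprz.
  split; first by move=> k k0; rewrite SE.
  apply: (conclude (fun p => (p.2%:R + 1) `^ c2) (zeta_bound c2))
    => [|p|s /Sgrid s0|P uP hP].
  + exact: zb.
  + by [].
  + by rewrite /criterion_at hE // ltr0n.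
  + rewrite -(big_map snd xpredT (fun y : nat => ((y%:R + 1) `^ c2)^-1)).
    apply: zeta_uniq => //; rewrite map_inj_in_uniq // => -[x y] [x' y'].
    move=> /hP[k]; rewrite SE /= => -[-> _] /hP[k']; rewrite SE /= => -[-> _].
    by move=> ->.
- have j0 : j = 0%N by rewrite /j beE divff ?gt_eqF // ln1 mul0r ceil0.
  split; first by move=> k k0; rewrite SE.
  apply: (conclude (fun p => ((absz p.1)%:R + 1) `^ c1) (2 * zeta_bound c1))
    => [|p|s /Sgrid s0|P uP hP].
  + by rewrite mulr_gt0 ?zb.
  + by [].
  + by rewrite /criterion_at hE // ltr0n.
  + rewrite -(big_map fst xpredT (fun x : int => (((absz x)%:R + 1) `^ c1)^-1)).
    apply: zeta_uniq_int => //; rewrite map_inj_in_uniq // => -[x y] [x' y'].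
    move=> /hP[k]; rewrite SE /= => -[-> _] /hP[k']; rewrite SE /= => -[-> _].
    by move=> ->.
Qed.

(** If budget k+1 were listed after budget k+2, sortedness would contradict the strict growth of [h]
    in its third argument. *)
Lemma assignment_pred (S : set (int * nat * nat)%type) (h : R -> R -> R -> R)
    (phi : nat -> int * nat * nat) (i : int) (j k q : nat) :
  h_assignment h S phi -> S (i, j, k.+1) -> (0 < q)%N -> phi q = (i, j, k.+2) ->
  exists2 q', (0 < q' < q)%N & phi q' = (i, j, k.+1).
Proof.
move=> [crit _ _ [_ _ surj] sorted_phi] Sk q0 phiq.
have [q' /= q'0 phiq'] := surj _ Sk; exists q' => //; rewrite q'0 ltnNge.
apply/negP => qq'; have := sorted_phi _ _ q0 qq'; rewrite phiq phiq' leNgt /criterion_at /=.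
by rewrite (criterion_homo3 crit) // ltr_nat.
Qed.

End Schedules.

(** * Assembly at the rounded grid point; the constant [Chat] is chosen before the problem, so it
    depends only on its listed arguments *)

Theorem theorem1p1 (R : realType) :
  exists Chat : forall r a b alpha betas alpha0 beta0 d1 d2 C eps0 : R, R,
  forall (n : nat) (D Q : set (Cn R n)) (f g : Cn R n -> R)
    (d : Cn R n -> Cn R n -> R)
    (Gamma : R -> R -> Cn R n -> Cn R n) (iters : R -> R -> Cn R n -> nat)
    (cost : R -> R -> nat)
    (alpha beta eta a b r alpha0 beta0 eps0 : R)
    (S : set (int * nat * nat)%type) (h : R -> R -> R -> R)
    (phi : nat -> int * nat * nat) (x0 : Cn R n),
  convex_problem D f Q ->
  is_metric d ->
  feasibility_gap D Q d g ->
  first_order_method D f Q g d Gamma iters cost ->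
  0 < alpha -> 1 <= beta -> 0 <= eta ->
  approx_sharp D f Q g d alpha beta eta ->
  1 < a -> 1 < b -> 0 < r < 1 -> 0 < alpha0 -> 1 <= beta0 -> beta0 <= beta ->
  D x0 -> 0 < eps0 -> total_gap f Q g x0 <= eps0 ->
  [\/ unknown_alpha_beta S h, known_alpha a alpha0 alpha S h
    | known_beta beta0 beta S h] ->
  h_assignment h S phi ->
  let alphas := alpha_star a alpha0 alpha in
  let betas := beta_star b beta0 beta in
  let K e := (total_cost cost b r beta0 eps0 alphas betas e)%:R : R in
  (exists2 c : R, 0 < c &
    \forall e \near 0^'+, forall (t : nat) (s : nat -> state),
      c * K e <= t%:R ->
      restart_run f g Gamma cost phi a b r alpha0 beta0 eps0 x0 t s ->
      total_gap f Q g (iterate (s t)) <= Num.max eta e)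
  /\
  (forall C d1 d2 : R, 0 < C -> 0 < d1 -> 0 < d2 ->
    (forall delta eps : R, 0 < delta -> 0 < eps ->
      (cost delta eps)%:R <= C * delta `^ d1 / eps `^ d2 + 1) ->
    forall e : R, 0 < e < eps0 ->
      K e <= Chat r a b alpha betas alpha0 beta0 d1 d2 C eps0 *
        (if d2 <= d1 / betas
         then eps0 `^ (d1 / betas - d2) * (Num.ceil (ln (eps0 / e)))%:~R
         else e `^ (d1 / betas - d2) * (Num.ceil (ln (eps0 / e)))%:~R)).
Proof.
exists cost_factor => n D Q f g d Gamma iters cost alpha beta eta a b r alpha0 beta0.
move=> eps0 S h phi x0 _ _ _ method al be1 eta0 sharp a1 b1 rr al0 be01 bebe Dx0.
move=> e00 gap0 cases hphi alphas betas K.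
have a0 := lt_trans ltr01 a1; have b0 := lt_trans ltr01 b1.
have be0 := lt_le_trans ltr01 be01; have be := lt_le_trans ltr01 be1.
have bs0 : 0 < betas by exact: lt_le_trans (beta_star_ge b1 be0 be).
split; last first.
  move=> C d1 d2 C0 d10 d20 hcost e ee.
  exact: total_cost_le.
have [Sij [c c0 hc]] := schedule_rank b a1 al0 be0 cases hphi.
set i := Num.floor _ in Sij hc; set j := absz _ in Sij hc.
have betasE : betas = b ^+ j * beta0 by exact: beta_starE.
have [r0 r1] := andP rr.
(* The constant is the slope of the rank bound, fixed before [e]; sufficiently small means
   [e < eps0]. *)
exists c => //; near=> e => t s cK run.
have ee : 0 < e < eps0.
  by apply/andP; split; near: e; [exact: nbhs_right_gt|exact: nbhs_right_lt].
set p := restart_count r eps0 e.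
have KE : K e = (cumulative_cost cost a b r alpha0 beta0 eps0 i j p)%:R.
  by rewrite /K /total_cost betasE.
have [_ p0] := restart_countE rr ee.
(* Budgets start at 1, so the sum must be positive for it to be the budget of a triple in [S]. *)
have K0 : (0 < cumulative_cost cost a b r alpha0 beta0 eps0 i j p)%N.
  rewrite -[p]prednK // cumulative_costS addn_gt0.
  by rewrite (unit_cost_gt0 _ _ _ _ method) ?orbT.
have [_ _ surj] := assignment_bij hphi.
have [m /= m0 phim] := surj _ (Sij _ K0).
have mt : (m <= t)%N.
  rewrite -(ler_nat R); apply: le_trans (hc _ _ m0 phim) _.
  by rewrite -KE.
apply: (@le_trans _ _ (Num.max eta (r ^+ p * eps0))); last first.
  by rewrite ge_max !le_max lexx (restart_count_le rr ee) orbT.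
apply: (run_gap method _ _ _ _ _ _ _ _ _ phim run (ltW r1)) => //.
(* The nonnegativity part of the sharpness condition makes the power monotone in its base. *)
- move=> x u Dx u0 gapu; have [gx dx] := sharp _ Dx.
  apply: le_trans dx _; apply: sharp_radius => //; first exact: alpha_star_le.
  by rewrite -betasE beta_star_ge ?beta_star_le.
- by move=> q k q0; exact: assignment_pred hphi (Sij _ _) q0.
- by rewrite m0.
Unshelve. all: by end_near.
Qed.
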